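(* Let $X$ be a separable infinite-dimensional Hilbert space, let $(\Sigma,S,\mu)$ be a measure space such that $Y=L^2(\Sigma,\mu)$ is a separable infinite-dimensional Hilbert space, and let $P\colon X\to Y$ be an injective bounded linear operator. Let $\mathrm{e}=\{\mathrm{e}_k\}_{k\in\mathbb{N}}$ be an orthonormal basis of $X$. Let $(\beta_k^\nu)_{k\in\mathbb{N}}$ be a sequence of independent random variables of Bernoulli type with mean $0$ and variance $1$ on a probability space $(A,\mathcal{A},\mathbb{P})$. Let $x=\sum_{k=1}^\infty x_k\mathrm{e}_k\in X\setminus\{0\}$ and $x^\nu=\sum_{k=1}^\infty \beta_k^\nu x_k\mathrm{e}_k$. Then, for every $\delta>0$, $$\mathbb{P}\left(\|Px^\nu\|_Y\ge\delta\|x^\nu\|_X\right)\le\exp\left(2-\frac{1}{e}\,\frac{\delta}{\sqrt{K_{\mathrm{rand}}(\mathrm{e})}}\right),$$ where $K_{\mathrm{rand}}(\mathrm{e})=\sup_{k}\|P(\mathrm{e}_k)\|_Y^2$.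
   Context: $X$ and $Y$ are Hilbert spaces over the same scalar field ($\mathbb{R}$ or $\mathbb{C}$). A random variable of Bernoulli type with mean $0$ and variance $1$ is one with $\mathbb{P}(\beta=1)=\mathbb{P}(\beta=-1)=\frac12$; $\nu\in A$ denotes the random event. On the right-hand side, the roman-type basis symbol $\mathrm{e}$ in $K_{\mathrm{rand}}(\mathrm{e})$ is the orthonormal basis, while $e$ in the factor $\frac1e$ is Euler's number. *)

(* Defs.v *)
From HB Require Import structures.
From mathcomp Require Import all_boot all_order all_algebra.
From mathcomp Require Import finmap generic_quotient ring_quotient complex.
From mathcomp Require Import all_classical all_reals all_analysis.
From mathcomp Require Import measurable_realfun.

Set Implicit Arguments.
Unset Strict Implicit.
Unset Printing Implicit Defensive.

Import Order.TTheory GRing.Theory Num.Theory.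
Import numFieldNormedType.Exports.

Local Open Scope classical_set_scope.
Local Open Scope ring_scope.

Variant scalar_kind := RealScalars | ComplexScalars.

Definition scalars (R : realType) (F : scalar_kind) : numFieldType :=
  match F with
  | RealScalars => R
  | ComplexScalars => R[i]
  end.

Definition sre (R : realType) (F : scalar_kind) : scalars R F -> R :=
  match F with
  | RealScalars => idfun
  | ComplexScalars => @complex.Re R
  end.

Definition sim (R : realType) (F : scalar_kind) : scalars R F -> R :=
  match F with
  | RealScalars => fun=> 0
  | ComplexScalars => @complex.Im R
  end.

Definition sofR (R : realType) (F : scalar_kind) : R -> scalars R F :=
  match F with
  | RealScalars => idfun
  | ComplexScalars => fun x => Complex x 0
  end.

Definition sconj (R : realType) (F : scalar_kind) :
    scalars R F -> scalars R F :=
  match F with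
  | RealScalars => idfun
  | ComplexScalars => @conjc R
  end.

Section scalars_theory.
Context {R : realType} {F : scalar_kind}.
Local Notation K := (scalars R F).

Lemma sreD : {morph (@sre R F) : x y / x + y}.
Proof. by case: F => //= -[a b] [c d]. Qed.

Lemma simD : {morph (@sim R F) : x y / x + y}.
Proof. by case: F => [x y|[a b] [c d]] //=; rewrite addr0. Qed.

Lemma sreM (x y : K) : sre (x * y) = sre x * sre y - sim x * sim y.
Proof. by case: F x y => [x y|[a b] [c d]] //=; rewrite mulr0 subr0. Qed.

Lemma simM (x y : K) : sim (x * y) = sre x * sim y + sim x * sre y.
Proof.
by case: F x y => [x y|[a b] [c d]] //=; rewrite mulr0 mul0r addr0.
Qed.

Lemma sre0 : sre (0 : K) = 0.
Proof. by case: F. Qed.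

Lemma sre_le (x y : K) : x <= y -> sre x <= sre y.
Proof. by case: F x y => //= x y; rewrite lecE => /andP[]. Qed.

Lemma sofR_sre_norm (x : K) : sofR F (sre `|x|) = `|x|.
Proof. by case: F x => //= -[a b]; rewrite normc_def. Qed.

Lemma sofRK (x : R) : sre (sofR F x) = x.
Proof. by case: F. Qed.

Lemma sofR_le (x y : R) : (sofR F x <= sofR F y) = (x <= y).
Proof. by case: F => //=; rewrite lecE /= eqxx. Qed.

Lemma sofRD : {morph @sofR R F : x y / x + y}.
Proof. by case: F => //= x y; rewrite /= /GRing.add /= addr0. Qed.

Lemma sofRM : {morph @sofR R F : x y / x * y}.
Proof.
case: F => //= x y; rewrite /GRing.mul /=.
by rewrite !(mulr0, mul0r) addr0 subr0.
Qed.

Lemma sofR0 : sofR F (0 : R) = 0.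
Proof. by case: F. Qed.

Lemma norm_sofR (x : R) : `|sofR F x| = sofR F `|x|.
Proof.
by case: F => //=; rewrite normc_def /= expr0n /= addr0 sqrtr_sqr.
Qed.

End scalars_theory.

(** [rnorm v] is the norm of [v] as an element of [R]: the library norm of a
    normed module over [K] takes its values in [K]. *)
Definition rnorm (R : realType) (F : scalar_kind)
    (V : normedZmodType (scalars R F)) (v : V) : R := sre `|v|.

Section rnorm_theory.
Context {R : realType} {F : scalar_kind}.
Local Notation K := (scalars R F).

Lemma rnormK (V : normedZmodType K) (v : V) : sofR F (rnorm v) = `|v|.
Proof. by rewrite /rnorm -(normr_id v) sofR_sre_norm. Qed.

Lemma rnorm_ge0 (V : normedZmodType K) (v : V) : 0 <= rnorm v.
Proof. by rewrite -(sofR_le (F := F)) rnormK sofR0. Qed.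

Lemma rnormD (V : normedZmodType K) (v w : V) :
  rnorm (v + w) <= rnorm v + rnorm w.
Proof. by rewrite -(sofR_le (F := F)) sofRD !rnormK ler_normD. Qed.

Lemma rnormM (x y : K) : rnorm (x * y) = rnorm x * rnorm y.
Proof.
by rewrite -[LHS](sofRK (F := F)) -[RHS](sofRK (F := F)) sofRM !rnormK normrM.
Qed.

Lemma rnorm0_eq0 (V : normedZmodType K) (v : V) : rnorm v = 0 -> v = 0.
Proof. by move=> v0; apply/normr0_eq0; rewrite -rnormK v0 sofR0. Qed.

Lemma rnorm0 (V : normedZmodType K) : rnorm (0 : V) = 0.
Proof. by rewrite /rnorm normr0 sre0. Qed.

Lemma rnormE (x : K) : rnorm x = Num.sqrt (sre x ^+ 2 + sim x ^+ 2).
Proof.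
have e y : sre `|y : K| = Num.sqrt (sre y ^+ 2 + sim y ^+ 2).
  by case: F y => [y|[a b]] //=; rewrite expr0n addr0 sqrtr_sqr.
exact: e.
Qed.

End rnorm_theory.

Section L2fun.
Context d (T : measurableType d) (R : realType) (F : scalar_kind).
Variable mu : {measure set T -> \bar R}.
Local Notation K := (scalars R F).

Definition square_integrable (f : T -> K^o) : Prop :=
  [/\ measurable_fun setT (@sre R F \o f), measurable_fun setT (@sim R F \o f)
    & finite_norm mu 2%:E (fun t => rnorm (f t : K))].

Definition L2pred : {pred T -> K^o} := mem [set f | square_integrable f].

Lemma L2predP (f : T -> K^o) : f \in L2pred <-> square_integrable f.
Proof. by rewrite !inE. Qed.

Lemma measurable_rnorm_re_im (f : T -> K^o) :
  measurable_fun setT (@sre R F \o f) -> measurable_fun setT (@sim R F \o f) ->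
  measurable_fun setT (fun t => rnorm (f t : K)).
Proof.
move=> mr mi.
rewrite (_ : (fun t => _) = @Num.sqrt R \o
    ((fun t => (@sre R F \o f) t ^+ 2) \+ (fun t => (@sim R F \o f) t ^+ 2))).
  apply: measurableT_comp.
    by apply: continuous_measurable_fun; exact: sqrt_continuous.
  by apply: measurable_funD; exact: measurable_funX.
by apply/funext => t; exact: rnormE.
Qed.

Lemma measurable_rnorm (f : T -> K^o) : square_integrable f ->
  measurable_fun setT (fun t => rnorm (f t : K)).
Proof. by case=> mr mi _; exact: measurable_rnorm_re_im. Qed.

Lemma Lnorm2_le (g h : T -> R) : measurable_fun setT g ->
  measurable_fun setT h -> (forall t, `|g t| <= `|h t|) ->
  ('N[mu]_2%:E[EFin \o g] <= 'N[mu]_2%:E[EFin \o h])%E.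
Proof.
move=> mg mh gh; rewrite unlock /Lnorm.
have N0 (k : T -> R) : (\int[mu]_t `|(EFin \o k) t| `^ 2 \in `[0, +oo])%E.
  by rewrite in_itv/= leey andbT integral_ge0.
apply: (gt0_ler_poweR _ (N0 g) (N0 h)); first by rewrite invr_ge0.
apply: ge0_le_integral => //=.
- apply/measurable_EFinP.
  apply: (@measurableT_comp _ _ _ _ _ _ (@powR R ^~ 2)) => //.
  exact: measurableT_comp.
- apply/measurable_EFinP.
  apply: (@measurableT_comp _ _ _ _ _ _ (@powR R ^~ 2)) => //.
  exact: measurableT_comp.
- by move=> t _; rewrite lee_fin ge0_ler_powR// nnegrE.
Qed.

Lemma L2_triangle (f g : T -> K^o) : square_integrable f ->
  square_integrable g -> measurable_fun setT (fun t => rnorm (f t + g t : K)) ->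
  ('N[mu]_2%:E[EFin \o (fun t => rnorm (f t + g t : K))] <=
   'N[mu]_2%:E[EFin \o (fun t => rnorm (f t : K))] +
   'N[mu]_2%:E[EFin \o (fun t => rnorm (g t : K))])%E.
Proof.
move=> sf sg mfg.
apply: le_trans; last first.
  apply: (@minkowski_EFin _ _ _ mu (fun t => rnorm (f t : K))
    (fun t => rnorm (g t : K)) 2); rewrite ?ler1n//; exact: measurable_rnorm.
apply: Lnorm2_le => //.
  by apply: measurable_funD; exact: measurable_rnorm.
move=> t /=; rewrite !ger0_norm ?rnorm_ge0 ?addr_ge0 ?rnorm_ge0//.
exact: rnormD.
Qed.

Lemma L2_scale (a : K) (f : T -> K^o) : square_integrable f ->
  ('N[mu]_2%:E[EFin \o (fun t => rnorm (a * f t : K))] =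
   (rnorm a)%:E * 'N[mu]_2%:E[EFin \o (fun t => rnorm (f t : K))])%E.
Proof.
move=> sf; have mf := measurable_rnorm sf; case: (sf) => _ _ ff.
have p1 : (1 <= 2%:E :> \bar R)%E by rewrite lee_fin ler1n.
have fL : (fun t => rnorm (f t : K)) \in Lfun mu 2%:E.
  by apply/andP; split; rewrite inE.
have := LnormZ (Lfun_Sub p1 fL) (rnorm a).
rewrite Lfun_valP ger0_norm ?rnorm_ge0// => <-.
by apply: eq_Lnorm => t /=; rewrite rnormM.
Qed.

Lemma sqintD_measurable (f g : T -> K^o) :
  square_integrable f -> square_integrable g ->
  measurable_fun setT (@sre R F \o (f + g)) /\
  measurable_fun setT (@sim R F \o (f + g)).
Proof.
move=> [fr fi _] [gr gi _]; split.
  rewrite (_ : _ \o _ = (@sre R F \o f) \+ (@sre R F \o g)).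
    exact: measurable_funD.
  by apply/funext => t; exact: sreD.
rewrite (_ : _ \o _ = (@sim R F \o f) \+ (@sim R F \o g)).
  exact: measurable_funD.
by apply/funext => t; exact: simD.
Qed.

Lemma L2_submod_closed : submod_closed L2pred.
Proof.
have H0 : square_integrable 0.
  have e0 : (fun t => rnorm (0 : K)) = cst 0 :> (T -> R).
    by apply/funext => t; rewrite rnorm0.
  split => /=.
  - by rewrite (_ : _ \o _ = cst (sre (0 : K))).
  - by rewrite (_ : _ \o _ = cst (sim (0 : K))).
  - rewrite (_ : (fun t => _) = cst 0) //.
    by apply: finite_norm_cst0; rewrite lee_fin ler1n.
have HZ (a : K) (f : T -> K^o) : square_integrable f ->
    square_integrable (a *: f).
  move=> sf; case: (sf) => fr fi ff; split.
  - rewrite (_ : _ \o _ =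
      (fun t => sre a * sre (f t : K) - sim a * sim (f t : K))).
      by apply: measurable_funB; exact: measurable_funM.
    by apply/funext => t; exact: sreM.
  - rewrite (_ : _ \o _ =
      (fun t => sre a * sim (f t : K) + sim a * sre (f t : K))).
      by apply: measurable_funD; exact: measurable_funM.
    by apply/funext => t; exact: simM.
  - rewrite /finite_norm (L2_scale a sf).
    by rewrite lte_mul_pinfty ?lee_fin ?rnorm_ge0.
split; first exact/L2predP.
move=> a f g /L2predP/(HZ a) sf /L2predP sg; apply/L2predP.
have [mr mi] := sqintD_measurable sf sg.
split=> //; rewrite /finite_norm.
apply: (le_lt_trans (L2_triangle sf sg _)); first exact: measurable_rnorm_re_im.
by case: sf => _ _ sf; case: sg => _ _ sg; rewrite lte_add_pinfty.
Qed.

HB.instance Definition _ := GRing.isSubmodClosed.Build K (T -> K^o) L2pred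
  L2_submod_closed.

Record L2fun := L2Fun { L2val :> T -> K^o; _ : L2val \in L2pred }.

HB.instance Definition _ := [isSub for L2val].
HB.instance Definition _ := [Choice of L2fun by <:].
HB.instance Definition _ := [SubChoice_isSubLmodule of L2fun by <:].

Lemma L2funBE (f g : L2fun) t : (f - g) t = f t - g t :> K.
Proof. by []. Qed.

Lemma L2funDE (f g : L2fun) t : (f + g) t = f t + g t :> K.
Proof. by []. Qed.

Lemma L2funZE (a : K) (f : L2fun) t : (a *: f) t = a * f t :> K.
Proof. by []. Qed.

End L2fun.

Section L2.
Context d (T : measurableType d) (R : realType) (F : scalar_kind).
Variable mu : {measure set T -> \bar R}.
Local Notation K := (scalars R F).
Local Notation L2fun := (L2fun F mu).

Definition null_fun : {pred L2fun} :=
  mem [set f : L2fun | {ae mu, forall t, f t = 0}].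

Lemma null_funP (f : L2fun) : f \in null_fun <-> {ae mu, forall t, f t = 0}.
Proof. by rewrite !inE. Qed.

Lemma null_fun_zmod_closed : zmod_closed null_fun.
Proof.
split; first by apply/null_funP/aeW.
move=> f g /null_funP f0 /null_funP g0; apply/null_funP.
apply: filterS2 f0 g0 => t f0 g0.
by rewrite L2funBE f0 g0 subr0.
Qed.

HB.instance Definition _ := GRing.isZmodClosed.Build L2fun null_fun
  null_fun_zmod_closed.

(** [L2] inherits the additive structure of the quotient of the square
    integrable functions by the subgroup of the functions that vanish almost
    everywhere; the scaling by [K] and the norm are defined on
    representatives. *)
Definition L2 : Type := Quotient.quot null_fun.

HB.instance Definition _ := GRing.Zmodule.on L2.
HB.instance Definition _ := EqQuotient.on L2.

Local Open Scope quotient_scope.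

Definition L2class (f : L2fun) : L2 := \pi_(Quotient.quot null_fun) f.

Lemma L2class_eq (f g : L2fun) :
  L2class f = L2class g <-> {ae mu, forall t, f t = g t}.
Proof.
rewrite /L2class.
have -> : (\pi_(Quotient.quot null_fun) f = \pi_(Quotient.quot null_fun) g) <->
    f - g \in null_fun.
  by rewrite Quotient.idealrBE; split => [/eqP|/eqP].
rewrite null_funP; split; apply: filterS => t.
  by rewrite L2funBE => /eqP; rewrite subr_eq0 => /eqP.
by move=> fg; rewrite L2funBE fg subrr.
Qed.

Lemma L2classD f g : L2class (f + g) = L2class f + L2class g.
Proof. by rewrite /L2class raddfD. Qed.

Definition L2rep (u : L2) : L2fun := repr u.

Lemma L2classK (u : L2) : L2class (L2rep u) = u.
Proof. exact: reprK. Qed.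

Definition L2scale (a : K) (u : L2) : L2 := L2class (a *: L2rep u).

Lemma L2scale_class a f : L2scale a (L2class f) = L2class (a *: f).
Proof.
apply/L2class_eq.
have /L2class_eq := L2classK (L2class f).
by apply: filterS => t e; rewrite !L2funZE e.
Qed.

Lemma L2scaleA a b u : L2scale a (L2scale b u) = L2scale (a * b) u.
Proof. by rewrite -(L2classK u) !L2scale_class scalerA. Qed.

Lemma L2scale1 : left_id 1 L2scale.
Proof. by move=> u; rewrite -(L2classK u) !L2scale_class scale1r. Qed.

Lemma L2scaleDr : right_distributive L2scale +%R.
Proof.
move=> a u v; rewrite -(L2classK u) -(L2classK v) -L2classD !L2scale_class.
by rewrite scalerDr L2classD.
Qed.

Lemma L2scaleDl u : {morph L2scale^~ u : a b / a + b}.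
Proof.
by move=> a b; rewrite -(L2classK u) !L2scale_class scalerDl L2classD.
Qed.

HB.instance Definition _ := GRing.Zmodule_isLmodule.Build K L2
  L2scaleA L2scale1 L2scaleDr L2scaleDl.

Definition L2fun_norm (f : L2fun) : R :=
  fine ('N[mu]_2%:E[EFin \o (fun t => rnorm (f t : K))])%E.

Definition L2norm (u : L2) : K := sofR F (L2fun_norm (L2rep u)).

Lemma L2fun_square_integrable (f : L2fun) : square_integrable mu f.
Proof. by apply/L2predP; case: f. Qed.

Lemma L2fun_normE (f : L2fun) :
  (L2fun_norm f)%:E = 'N[mu]_2%:E[EFin \o (fun t => rnorm (f t : K))]%E.
Proof.
rewrite /L2fun_norm fineK// ge0_fin_numE ?Lnorm_ge0//.
by case: (L2fun_square_integrable f).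
Qed.

Lemma L2norm_class (f : L2fun) : L2norm (L2class f) = sofR F (L2fun_norm f).
Proof.
congr sofR; rewrite /L2fun_norm; congr fine.
have /L2class_eq := L2classK (L2class f); move: (L2rep _) => g e.
rewrite unlock /Lnorm; apply: (congr1 (@poweR R ^~ _)).
apply: ae_eq_integral => //=.
- apply/measurable_EFinP.
  apply: (@measurableT_comp _ _ _ _ _ _ (@powR R ^~ 2)) => //.
  apply: measurableT_comp => //; apply: measurable_rnorm.
  exact: L2fun_square_integrable.
- apply/measurable_EFinP.
  apply: (@measurableT_comp _ _ _ _ _ _ (@powR R ^~ 2)) => //.
  apply: measurableT_comp => //; apply: measurable_rnorm.
  exact: L2fun_square_integrable.
- by apply: filterS e => t e _ /=; rewrite e.
Qed.

Lemma L2normD u v : L2norm (u + v) <= L2norm u + L2norm v.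
Proof.
rewrite -(L2classK u) -(L2classK v) -L2classD !L2norm_class.
rewrite -sofRD sofR_le -lee_fin EFinD !L2fun_normE.
move: (L2rep u) (L2rep v) => f g.
have E : (fun t => rnorm ((f + g) t : K)) = (fun t => rnorm (f t + g t : K)).
  by apply/funext => t; rewrite L2funDE.
have := measurable_rnorm (L2fun_square_integrable (f + g)); rewrite E.
exact: L2_triangle (L2fun_square_integrable f) (L2fun_square_integrable g).
Qed.

Lemma L2normZ a u : L2norm (a *: u) = `|a| * L2norm u.
Proof.
rewrite -(L2classK u) -[_ *: _]/(L2scale _ _) L2scale_class !L2norm_class.
rewrite -rnormK -sofRM; congr sofR; apply: EFin_inj.
rewrite EFinM !L2fun_normE; move: (L2rep u) => f.
have E : (fun t => rnorm ((a *: f) t : K)) = (fun t => rnorm (a * f t : K)).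
  by apply/funext => t; rewrite L2funZE.
by rewrite E (L2_scale a (L2fun_square_integrable f)).
Qed.

Lemma L2norm0_eq0 u : L2norm u = 0 -> u = 0.
Proof.
rewrite -(L2classK u) L2norm_class => /(congr1 (@sre R F)).
rewrite sofRK sre0 => e; have := L2fun_normE (L2rep u); rewrite e => /esym N0.
have -> : L2class (L2rep u) = L2class 0.
  apply/L2class_eq.
  have mu_ := measurable_rnorm (L2fun_square_integrable (L2rep u)).
  have : ae_eq mu setT (EFin \o (fun t => rnorm (L2rep u t : K))) (cst 0%E).
    apply: Lnorm_eq0_eq0 N0; last by rewrite lte_fin.
    exact/measurable_EFinP.
  by apply: filterS => t /(_ I) /= [e0]; exact: (rnorm0_eq0 e0).
by rewrite /L2class raddf0.
Qed.

HB.instance Definition _ := Lmodule_isNormed.Build K L2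
  L2normD L2normZ L2norm0_eq0.

Lemma L2_normE (f : L2fun) : `|L2class f| = sofR F (L2fun_norm f).
Proof. exact: L2norm_class. Qed.

End L2.

Section hilbert.
Context (R : realType) (F : scalar_kind).
Local Notation K := (scalars R F).

(** A Hilbert space over [K] is a [completeNormedModType K] with an inner
    product [dot], conjugate-linear in its second argument, that induces the
    norm. *)
Definition induces_norm (X : normedModType K) (dot : {dot X for @sconj R F}) :=
  forall x : X, `|x| ^+ 2 = dot x x.

Definition separable (X : topologicalType) :=
  exists2 D : set X, countable D & dense D.

Definition infinite_dimensional (X : lmodType K) :=
  ~ exists (n : nat) (v : 'I_n -> X),
      forall x : X, exists c : 'I_n -> K, x = \sum_(i < n) c i *: v i.

Definition bounded_operator (X Y : normedModType K) (P : X -> Y) :=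
  exists M : R, forall x : X, rnorm (P x) <= M * rnorm x.

Definition linear_span (X : lmodType K) (e : nat -> X) : set X :=
  [set x | exists (n : nat) (c : nat -> K), x = \sum_(i < n) c i *: e i].

Definition orthonormal_basis (X : normedModType K)
    (dot : {dot X for @sconj R F}) (e : nat -> X) :=
  (forall i j, dot (e i) (e j) = (i == j)%:R) /\ dense (linear_span e).

Definition K_rand (X Y : normedModType K) (P : X -> Y) (e : nat -> X) : R :=
  sup (range (fun k => rnorm (P (e k)) ^+ 2)).

(** The limit is the sum of the series on the almost sure event where all the
    signs [b k] are 1 or -1; where the series diverges, [limn] returns an
    arbitrary fixed value. *)
Definition randomized (X : normedModType K) (e : nat -> X) (x : nat -> K)
    (b : nat -> R) : X :=
  limn (series (fun k => (sofR F (b k) * x k) *: e k)).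

End hilbert.

Section probability.
Context d (A : measurableType d) (R : realType) (Pr : probability A R).

Definition mutually_independent (X : nat -> {RV Pr >-> R}) :=
  forall (J : seq nat) (B : nat -> set R), uniq J ->
    (forall k, measurable (B k)) ->
    Pr (\bigcap_(k in [set` J]) (X k @^-1` B k)) =
    (\prod_(k <- J) Pr (X k @^-1` B k))%E.

Definition bernoulli_type (X : {RV Pr >-> R}) :=
  Pr (X @^-1` [set 1]) = (2^-1)%:E /\ Pr (X @^-1` [set -1]) = (2^-1)%:E.

End probability.

(* Main.v *)
(** For a fixed choice of signs, [rnorm x^nu = rnorm x], so only the tail of the
    Rademacher sum of [v k = c k *: P (e k)] matters, where
    [\sum_k rnorm (v k) ^+ 2 <= tau := K_rand P e * rnorm x ^+ 2]. The norm of
    [L2] satisfies the parallelogram law, and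
    [cosh y <= expR (2 * y ^+ 2)] then bounds the mean of
    [expR (s * rnorm (u + v) ^+ 2)] and [expR (s * rnorm (u - v) ^+ 2)] by
    [expR (s * rnorm v ^+ 2 + s * (1 + 8 * s * rnorm v ^+ 2) * rnorm u ^+ 2)].
    Removing the terms one at a time gives, with [s = (16 * tau)^-1], the
    sub-Gaussian bound [expR (1/8 - r ^+ 2 / (16 * tau))] for the probability
    that the norm of a partial sum is at least [r]. It is stronger than the
    exponential bound, even for [r] equal to 3/4 of the threshold; this slack
    makes the passage to the infinite sum a mere limit inferior of events. *)
Require Import Defs.
From HB Require Import structures.
From mathcomp Require Import all_boot all_order all_algebra.
From mathcomp Require Import all_classical all_reals all_analysis.
From mathcomp Require Import measurable_realfun complex ring lra.

Set Implicit Arguments.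
Unset Strict Implicit.
Unset Printing Implicit Defensive.

Import Order.TTheory GRing.Theory Num.Theory.
Import numFieldNormedType.Exports.

Local Open Scope classical_set_scope.
Local Open Scope ring_scope.

(** * Scalar exponential inequalities *)

Section exponential_bounds.
Context {R : realType}.
Implicit Types x y : R.

Lemma expR_le_inv x : x < 1 -> expR x <= (1 - x)^-1.
Proof.
move=> x1; rewrite -[x in expR x]opprK expRN.
rewrite lef_pV2 ?posrE ?expR_gt0 ?subr_gt0//.
exact: expR_ge1Dx.
Qed.

(** For [x >= 1/2] both exponents are at most [2 * x ^+ 2]. For smaller [x] the geometric bound
    [expR x <= (1 - x)^-1] turns the mean into [(1 - x ^+ 2)^-1], which is at most
    [1 + 2 * x ^+ 2]. *)
Lemma cosh_le_expR_sqr x : (expR x + expR (- x)) / 2 <= expR (2 * x ^+ 2).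
Proof.
wlog x0 : x / 0 <= x.
  move=> h; have [|/ltW x0] := leP 0 x; first exact: h.
  by rewrite -sqrrN addrC -{2}(opprK x) h// oppr_ge0.
have [x1|x1] := leP (1 / 2) x.
  have : expR x <= expR (2 * x ^+ 2) by rewrite ler_expR; nra.
  have : expR (- x) <= expR (2 * x ^+ 2) by rewrite ler_expR; nra.
  lra.
have y1 : 0 < 1 - x ^+ 2 by nra.
have y2 : x ^+ 2 <= 1 / 2 by nra.
have hx : expR x <= (1 - x)^-1 by apply: expR_le_inv; lra.
have hNx : expR (- x) <= (1 - - x)^-1 by apply: expR_le_inv; lra.
have E : ((1 - x)^-1 + (1 - - x)^-1) / 2 = (1 - x ^+ 2)^-1.
  by field; rewrite opprK; apply/and3P; split; apply: lt0r_neq0; lra.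
have h1 : (1 - x ^+ 2)^-1 <= 1 + 2 * x ^+ 2.
  rewrite -[leLHS]mul1r ler_pdivrMr//.
  by have := sqr_ge0 x; nra.
have h2 := expR_ge1Dx (2 * x ^+ 2).
lra.
Qed.

(** Here [a], [b] stand for the norms of two vectors and [p], [q] for the squared norms of their sum
    and difference. The latter are [a ^+ 2 + b ^+ 2] plus and minus [2 * c], where [c] plays the
    real part of the inner product; the triangle inequality yields the Cauchy-Schwarz bound on [c],
    and what remains is a hyperbolic cosine at [2 * s * c]. *)
Lemma expR_parallelogram (s a b p q : R) : 0 <= s -> 0 <= a -> 0 <= b ->
  p + q = 2 * (a ^+ 2 + b ^+ 2) -> p <= (a + b) ^+ 2 -> q <= (a + b) ^+ 2 ->
  (expR (s * p) + expR (s * q)) / 2 <=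
  expR (s * (a ^+ 2 + b ^+ 2) + 8 * s ^+ 2 * a ^+ 2 * b ^+ 2).
Proof.
move=> s0 a0 b0 pq pab qab; pose c := (p - q) / 4.
have -> : s * p = s * (a ^+ 2 + b ^+ 2) + 2 * s * c by rewrite /c; nra.
have -> : s * q = s * (a ^+ 2 + b ^+ 2) + - (2 * s * c) by rewrite /c; nra.
have c2 : c ^+ 2 <= a ^+ 2 * b ^+ 2.
  rewrite -exprMn -ler_sqrt ?sqr_ge0// !sqrtr_sqr (ger0_norm (mulr_ge0 a0 b0)).
  by rewrite ler_norml /c; apply/andP; split; nra.
rewrite !expRD -mulrDr -mulrA ler_wpM2l ?expR_ge0//.
apply: (le_trans (cosh_le_expR_sqr _)); rewrite ler_expR.
have := ler_wpM2l (sqr_ge0 s) c2; nra.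
Qed.

End exponential_bounds.

(** * Real-valued norms and convergence *)

Section rnorm_lemmas.
Context {R : realType} {F : scalar_kind}.
Local Notation K := (scalars R F).

Lemma sofR1 : sofR F (1 : R) = 1.
Proof. by case: F. Qed.

Lemma sofRN1 : sofR F (- 1 : R) = - 1.
Proof. by case: F => //=; rewrite [RHS]/GRing.opp /= oppr0. Qed.

Lemma rnorm_sofR (a : R) : rnorm (sofR F a : K) = `|a|.
Proof. by rewrite /rnorm norm_sofR sofRK. Qed.

Lemma rnormZ (V : normedModType K) (a : K) (v : V) :
  rnorm (a *: v) = rnorm a * rnorm v.
Proof.
by rewrite -[LHS](sofRK (F := F)) -[RHS](sofRK (F := F)) sofRM !rnormK normrZ.
Qed.

Lemma rnormN (V : normedZmodType K) (v : V) : rnorm (- v) = rnorm v.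
Proof. by rewrite /rnorm normrN. Qed.

Lemma rnorm_dist_le (V : normedZmodType K) (v w : V) :
  `|rnorm v - rnorm w| <= rnorm (v - w).
Proof.
have h (x y : V) : rnorm x <= rnorm (x - y) + rnorm y.
  by rewrite -[in leLHS](subrK y x) rnormD.
rewrite ler_norml; have := h v w; have := h w v.
by rewrite -(rnormN (w - v)) opprB => *; apply/andP; split; lra.
Qed.

Lemma gt0_sofR (a : K) : 0 < a -> sofR F (sre a) = a.
Proof. by move=> a0; rewrite -(gtr0_norm a0) sofR_sre_norm. Qed.

Lemma sofR_lt (a b : R) : (sofR F a < sofR F b) = (a < b).
Proof.
rewrite !lt_neqAle sofR_le; congr (~~ _ && _).
by apply/eqP/eqP => [/(congr1 (@sre R F))|->//]; rewrite !sofRK.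
Qed.

Lemma rnorm_lt (V : normedZmodType K) (v : V) (a : R) :
  (`|v| < sofR F a) = (rnorm v < a).
Proof. by rewrite -rnormK sofR_lt. Qed.

Lemma cvg_rnorm_dist (V : normedModType K) (u : nat -> V) (l : V) :
  u @ \oo --> l <-> (fun n => rnorm (l - u n)) @ \oo --> (0 : R).
Proof.
split=> [/cvgrPdist_lt h|/cvgrPdist_lt h]; apply/cvgrPdist_lt => r r0.
  have r0' : 0 < sofR F r by rewrite -(sofR0 (F := F)) sofR_lt.
  near=> n; rewrite sub0r normrN ger0_norm ?rnorm_ge0// -rnorm_lt.
  near: n; exact: h.
have r0' : 0 < sre r by rewrite -sofR_lt gt0_sofR// sofR0.
near=> n; rewrite -(gt0_sofR r0) rnorm_lt -[ltLHS]ger0_norm ?rnorm_ge0//.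
rewrite -normrN -sub0r.
near: n; exact: h.
Unshelve. all: by end_near. Qed.

Lemma cvg_rnorm (V : normedModType K) (u : nat -> V) (l : V) :
  u @ \oo --> l -> (fun n => rnorm (u n)) @ \oo --> rnorm l.
Proof.
move/cvg_rnorm_dist => /cvgrPdist_lt h; apply/cvgrPdist_lt => r r0.
near=> n; apply: (le_lt_trans (rnorm_dist_le _ _)).
rewrite -[ltLHS]ger0_norm ?rnorm_ge0// -normrN -sub0r.
near: n; exact: h.
Unshelve. all: by end_near. Qed.

Lemma bounded_operator_cvg (V W : normedModType K) (P : {linear V -> W})
    (u : nat -> V) (l : V) :
  bounded_operator P -> u @ \oo --> l -> (fun n => P (u n)) @ \oo --> P l.
Proof.
move=> [M PM] /cvg_rnorm_dist ul; apply/cvg_rnorm_dist.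
apply: (@squeeze_cvgr _ _ _ _ (fun=> 0) (fun n => M * rnorm (l - u n))).
- by near=> n; rewrite rnorm_ge0 -linearB PM.
- exact: cvg_cst.
- by rewrite -(mulr0 M); apply: cvgMr.
Unshelve. all: by end_near. Qed.

(** A Cauchy criterion that compares with the single index [N]: all its quantifiers can be made
    countable, which serves measurability. *)
Lemma rnorm_cvgnP (V : completeNormedModType K) (u : nat -> V) :
  cvgn u <-> forall r : R, 0 < r ->
    exists N : nat, forall p, rnorm (u N - u (N + p)%N) < r.
Proof.
split=> [/cvg_ex[l /cvg_rnorm_dist/cvgrPdist_lt h] r r0|h].
  have [N _ hN] := h (r / 2) ltac:(lra).
  have {}hN n : (N <= n)%N -> rnorm (l - u n) < r / 2.
    by move=> /hN /=; rewrite sub0r normrN ger0_norm ?rnorm_ge0.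
  exists N => p; have -> : u N - u (N + p)%N = - (l - u N) + (l - u (N + p)%N).
    by rewrite opprB addrA subrK.
  apply: (le_lt_trans (rnormD _ _)); rewrite rnormN [ltRHS]splitr.
  by apply: ltrD; apply: hN => //; exact: leq_addr.
apply: cauchy_cvg; apply: cauchy_exP => r r0.
have r0' : 0 < sre r by rewrite -sofR_lt gt0_sofR// sofR0.
have [N hN] := h _ r0'; exists (u N).
apply: (filterS _ (nbhs_infty_ge N)) => n Nn.
rewrite /= -ball_normE /= -(gt0_sofR r0) rnorm_lt -(subnKC Nn).
exact: hN.
Qed.

End rnorm_lemmas.

(** * Parallelogram law in [L2] *)

Section L2_parallelogram.
Context d (T : measurableType d) (R : realType) (F : scalar_kind).
Variable mu : {measure set T -> \bar R}.
Local Notation K := (scalars R F).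

Lemma rnorm_L2class (f : L2fun F mu) : rnorm (L2class f) = L2fun_norm f.
Proof. by rewrite /rnorm L2_normE sofRK. Qed.

Lemma L2fun_norm_sqr (f : L2fun F mu) :
  ((L2fun_norm f) ^+ 2)%:E = (\int[mu]_t (rnorm (f t : K) ^+ 2)%:E)%E.
Proof.
have : (L2fun_norm f)%:E =
    ((\int[mu]_t (rnorm (f t : K) ^+ 2)%:E) `^ 2^-1)%E.
  rewrite L2fun_normE unlock /Lnorm; congr (poweR _ _).
  apply: eq_integral => t _ /=.
  by rewrite ger0_norm ?rnorm_ge0// powR_mulrn ?rnorm_ge0.
set I := (\int[mu]_t _)%E => fI.
have I0 : (0 <= I)%E by apply: integral_ge0 => t _; rewrite lee_fin sqr_ge0.
rewrite -(poweRe1 I0) -(mulVf (_ : 2 != 0 :> R)) ?pnatr_eq0//.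
by rewrite poweRrM -fI poweR_EFin powR_mulrn// -lee_fin fI poweR_ge0.
Qed.

Lemma rnorm_parallelogram (x y : K) :
  rnorm (x + y) ^+ 2 + rnorm (x - y) ^+ 2 = 2 * (rnorm x ^+ 2 + rnorm y ^+ 2).
Proof.
rewrite !rnormE !sqr_sqrtr ?addr_ge0 ?sqr_ge0//.
case: F x y => /= [x y|[a b] [a' b']] /=; ring.
Qed.

Lemma L2_parallelogram (u v : L2 F mu) :
  rnorm (u + v) ^+ 2 + rnorm (u - v) ^+ 2 = 2 * (rnorm u ^+ 2 + rnorm v ^+ 2).
Proof.
rewrite -(L2classK u) -(L2classK v); move: (L2rep u) (L2rep v) => f g.
have -> : L2class f - L2class g = L2class (f - g) by rewrite /L2class raddfB.
rewrite -L2classD !rnorm_L2class.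
have mf (h : L2fun F mu) :
    measurable_fun setT (fun t => (rnorm (h t : K) ^+ 2)%:E).
  apply/measurable_EFinP; apply: measurable_funX.
  exact: measurable_rnorm (L2fun_square_integrable h).
have p0 (h : L2fun F mu) t : (0 <= (rnorm (h t : K) ^+ 2)%:E)%E.
  by rewrite lee_fin sqr_ge0.
apply: EFin_inj; rewrite EFinM !EFinD !L2fun_norm_sqr -!ge0_integralD//.
rewrite -ge0_integralZl//; first last.
- by rewrite adde_ge0.
- by move=> t _; rewrite adde_ge0.
- exact: emeasurable_funD.
by apply: eq_integral => t _; rewrite -!EFinD -EFinM rnorm_parallelogram.
Qed.

End L2_parallelogram.

(** * Measurability and probabilities of random signed sums *)

Section random_signs.
Context d (A : measurableType d) (R : realType).

Lemma measurable_set_lt (f g : A -> R) : measurable_fun setT f ->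
  measurable_fun setT g -> measurable [set t | f t < g t].
Proof.
move=> mf mg; have := measurable_fun_ltr mf mg measurableT (Y := [set true]).
by rewrite setTI preimage_true; exact.
Qed.

Lemma measurable_set_le (D : set A) (f g : A -> R) : measurable D ->
  measurable_fun D f -> measurable_fun D g ->
  measurable (D `&` [set t | f t <= g t]).
Proof.
move=> mD mf mg; have := measurable_fun_ler mf mg mD (Y := [set true]).
by rewrite preimage_true; exact.
Qed.

(** The random parameter [b t] is approximated by rationals: [h (b t) t < r] holds iff
    [h q t + L * |b t - q| < r] for some rational [q], a countable union of measurable
    conditions. *)
Lemma measurable_lipschitz_comp (h : R -> A -> R) (b : A -> R) (L : R) :
  0 <= L -> (forall a, measurable_fun setT (h a)) ->
  (forall a a' t, `|h a t - h a' t| <= L * `|a - a'|) ->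
  measurable_fun setT b -> measurable_fun setT (fun t => h (b t) t).
Proof.
move=> L0 mh lh mb.
apply: (measurability _ (RGenInftyO.measurableE R)) => //.
move=> _ [_ [r ->] <-]; rewrite setTI.
have -> : (fun t => h (b t) t) @^-1` `]-oo, r[%classic =
    \bigcup_(q : rat) [set t | h (ratr q) t + L * `|b t - ratr q| < r].
  apply/seteqP; split => [t /=|t [q _ /=]]; rewrite in_itv/= => hr.
    (* Moving from [b t] to [q] costs [L * |b t - q|] in [h] and the same again in the correction
       term; the extra 1 keeps the denominator positive when [L = 0]. *)
    pose e := (r - h (b t) t) / (2 * L + 1).
    have L1 : 0 < 2 * L + 1 by lra.
    have e0 : 0 < e by rewrite divr_gt0// subr_gt0.
    have [q] := @rat_in_itvoo R (b t) (b t + e) ltac:(lra).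
    rewrite in_itv/= => /andP[bq qb]; exists q => //=.
    have := lh (ratr q) (b t) t; rewrite (distrC (ratr q)).
    have bqe : `|b t - ratr q| < e by rewrite ltr_norml; apply/andP; split; lra.
    rewrite ler_norml => /andP[_ h1].
    have h2 : `|b t - ratr q| * (2 * L + 1) < r - h (b t) t.
      by rewrite -ltr_pdivlMr.
    have := normr_ge0 (b t - ratr q); nra.
  have := lh (b t) (ratr q) t; rewrite ler_norml => /andP[_]; lra.
apply: bigcupT_measurable_rat => q; apply: measurable_set_lt => //.
apply: measurable_funD => //; apply: measurable_funM => //.
by apply: measurableT_comp => //; exact: measurable_funB.
Qed.

(** No sigma-algebra is put on [V]. Random terms are moved one at a time into the offset [u], on
    which the norm depends in a Lipschitz way. *)
Lemma measurable_rnorm_sum (F : scalar_kind) (V : normedModType (scalars R F))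
    (b : nat -> A -> R) (v : nat -> V) (n : nat) (u : V) :
  (forall k, measurable_fun setT (b k)) ->
  measurable_fun setT (fun t => rnorm (u + \sum_(k < n) sofR F (b k t) *: v k)).
Proof.
move=> mb; elim: n u => [u|n IH u].
  by under eq_fun do rewrite big_ord0; exact: measurable_cst.
under eq_fun do rewrite big_ord_recr /= addrCA addrC.
pose h a t := rnorm (u + sofR F a *: v n + \sum_(k < n) sofR F (b k t) *: v k).
apply: (@eq_measurable_fun _ _ _ _ _ (fun t => h (b n t) t)).
  by move=> t _; rewrite /h addrAC.
apply: (@measurable_lipschitz_comp h (b n) (rnorm (v n))) => //.
- exact: rnorm_ge0.
- by move=> a; exact: IH.
- move=> a a' t; apply: (le_trans (rnorm_dist_le _ _)).
  rewrite /h opprD addrACA subrr addr0 opprD addrACA subrr add0r.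
  rewrite -scalerBl rnormZ mulrC.
  suff -> : sofR F a - sofR F a' = sofR F (a - a') by rewrite rnorm_sofR.
  by rewrite sofRD -mulN1r -sofRN1 -sofRM mulN1r.
Qed.

Variable (Pr : probability A R) (beta : nat -> {RV Pr >-> R}).
Hypothesis indep : mutually_independent beta.
Hypothesis bern : forall k : nat, bernoulli_type (beta k).

Lemma measurable_beta_eq k a : measurable (beta k @^-1` [set a]).
Proof. exact: measurable_funPTI. Qed.

Lemma signs_event (m : nat) (s : nat -> bool) :
  let D := [set nu | forall k, (k < m)%N -> beta k nu = (-1) ^+ s k] in
  measurable D /\ Pr D = ((2^-1) ^+ m)%:E.
Proof.
have -> : [set nu | forall k, (k < m)%N -> beta k nu = (-1) ^+ s k] =
   \bigcap_(k in [set` iota 0 m]) (beta k @^-1` [set (-1) ^+ s k]).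
  apply/seteqP; split => nu /= h k.
    by rewrite /= mem_iota; exact: h.
  by move=> km; apply: h => /=; rewrite mem_iota.
split; first by apply: bigcap_measurableType => k _; exact: measurable_beta_eq.
rewrite indep ?iota_uniq//.
rewrite (eq_bigr (fun=> (2^-1)%:E)); last first.
  by move=> k _; have [h1 hN1] := bern k; case: (s k); rewrite ?expr1 ?expr0.
by rewrite prodEFin big_const_seq count_predT size_iota iter_mulr_1.
Qed.

(** The offset [u] is meant to contain already the terms whose signs are prescribed by [s]; only the
    first [n] signs still enter the sum. *)
Definition signs_tail_event (F : scalar_kind) (V : lmodType (scalars R F))
    (v : nat -> V) (Q : set V) (n m : nat) (s : nat -> bool) (u : V) : set A :=
  [set nu | [/\ forall k, (k < n)%N -> beta k nu = 1 \/ beta k nu = -1,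
    forall k, (n <= k < n + m)%N -> beta k nu = (-1) ^+ s k &
    Q (u + \sum_(k < n) sofR F (beta k nu) *: v k)]].

(* The last [m] signs are prescribed, so that only finite intersections of
   events [beta k = 1], [beta k = -1] occur and no expectation is needed. *)
Lemma signs_tail (F : scalar_kind) (V : lmodType (scalars R F))
    (v : nat -> V) (Q : set V) (G : nat -> V -> R) :
  (forall n u, (G n (u + v n) + G n (u - v n)) / 2 <= G n.+1 u) ->
  (forall u, 0 <= G 0%N u) -> (forall u, Q u -> 1 <= G 0%N u) ->
  forall n m (s : nat -> bool) u, measurable (signs_tail_event v Q n m s u) /\
    (Pr (signs_tail_event v Q n m s u) <= ((2^-1) ^+ m * G n u)%:E)%E.
Proof.
move=> GS G0 GQ; elim=> [|n IH] m s u; rewrite /signs_tail_event.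
  have [Qu|nQu] := pselect (Q u); last first.
    rewrite (_ : [set _ | _] = set0); last first.
      by apply/seteqP; split => // nu /= []; rewrite big_ord0 addr0.
    by rewrite measure0 lee_fin mulr_ge0 ?exprn_ge0 ?invr_ge0.
  rewrite (_ : [set _ | _] =
    [set nu | forall k, (k < m)%N -> beta k nu = (-1) ^+ s k]); last first.
    apply/seteqP; split => nu /= => [[_ h _] k km|h]; first by apply: h.
    by split => //; rewrite big_ord0 addr0.
  have [mD ->] := signs_event m s; split => //.
  by rewrite lee_fin ler_peMr ?exprn_ge0 ?invr_ge0// GQ.
(* Conditioning on sign number [n]: [false] prescribes 1 and [true] prescribes -1, and [v n] moves
   into the offset accordingly. *)
pose s' (a : bool) k := if k == n then a else s k.
have [m1 p1] := IH m.+1 (s' false) (u + v n).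
have [m2 p2] := IH m.+1 (s' true) (u - v n).
rewrite (_ : [set _ | _] = signs_tail_event v Q n m.+1 (s' false) (u + v n) `|`
    signs_tail_event v Q n m.+1 (s' true) (u - v n)); last first.
  apply/seteqP; split => nu /= => [[h1 h2]|].
    rewrite big_ord_recr /= addrCA addrC => h3.
    have hs (a : bool) : beta n nu = (-1) ^+ a ->
        forall k, (n <= k < n + m.+1)%N -> beta k nu = (-1) ^+ s' a k.
      move=> ha k; rewrite /s'; case: eqP => [->//|/eqP kn] /andP[nk km].
      by apply: h2; rewrite addSnnS km andbT ltn_neqAle eq_sym kn nk.
    have [bn|bn] := h1 n (ltnSn n); [left|right]; split.
    - by move=> k kn; apply: h1; exact: leqW.
    - exact: hs.
    - by move: h3; rewrite bn sofR1 scale1r.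
    - by move=> k kn; apply: h1; exact: leqW.
    - exact: hs.
    - by move: h3; rewrite bn sofRN1 scaleN1r.
  have hs (a : bool) :
    [/\ forall k, (k < n)%N -> beta k nu = 1 \/ beta k nu = -1,
      forall k, (n <= k < n + m.+1)%N -> beta k nu = (-1) ^+ s' a k &
      Q (u + (-1) ^+ a *: v n + \sum_(k < n) sofR F (beta k nu) *: v k)] ->
    [/\ forall k, (k < n.+1)%N -> beta k nu = 1 \/ beta k nu = -1,
      forall k, (n.+1 <= k < n.+1 + m)%N -> beta k nu = (-1) ^+ s k &
      Q (u + \sum_(k < n.+1) sofR F (beta k nu) *: v k)].
    move=> [h1 h2 h3]; have bn : beta n nu = (-1) ^+ a.
      by rewrite h2 /s' ?eqxx// leqnn addnS ltnS leq_addr.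
    split.
    - move=> k; rewrite ltnS leq_eqVlt => /predU1P[->|]; last exact: h1.
      by rewrite bn; case: (a); rewrite ?expr1 ?expr0; tauto.
    - move=> k /andP[nk km]; rewrite h2 -?addSnnS ?(ltnW nk)// /s'.
      by rewrite gtn_eqF.
    - move: h3; rewrite big_ord_recr /= bn addrCA addrC.
      by case: (a); rewrite ?expr1 ?expr0 ?sofR1 ?sofRN1.
  by case=> h; [apply: (hs false)|apply: (hs true)] => //; move: h;
    rewrite ?expr1 ?expr0 ?scale1r ?scaleN1r.
split; first exact: measurableU.
apply: (le_trans (measureU2 _ m1 m2)).
(* One of the [m.+1] factors [2^-1] turns the sum of the two bounds into the average controlled by
   [GS]. *)
apply: (le_trans (leeD p1 p2)); rewrite -EFinD lee_fin -mulrDr exprSr -mulrA.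
by rewrite ler_wpM2l ?exprn_ge0 ?invr_ge0// mulrC GS.
Qed.

End random_signs.

(** * Sub-Gaussian tail of signed sums under the parallelogram law *)

Lemma inv_sub_step (R : realFieldType) (L q : R) : 0 <= q -> q < L ->
  L^-1 + q * L^-1 ^+ 2 <= (L - q)^-1.
Proof.
move=> q0 qL; have L0 : 0 < L by lra.
rewrite -[leRHS]mul1r ler_pdivlMr ?subr_gt0//.
have -> : (L^-1 + q * L^-1 ^+ 2) * (L - q) = 1 - (q / L) ^+ 2.
  by field; exact: lt0r_neq0.
by rewrite gerBl sqr_ge0.
Qed.

Section parallelogram_tail.
Context d (A : measurableType d) (R : realType) (Pr : probability A R).
Variable beta : nat -> {RV Pr >-> R}.
Hypothesis indep : mutually_independent beta.
Hypothesis bern : forall k : nat, bernoulli_type (beta k).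
Context (F : scalar_kind) (V : normedModType (scalars R F)).
Hypothesis parallelogram : forall u v : V,
  rnorm (u + v) ^+ 2 + rnorm (u - v) ^+ 2 = 2 * (rnorm u ^+ 2 + rnorm v ^+ 2).

(* Averaging [expR (s * rnorm (u + v) ^+ 2)] over the sign of [v] multiplies the
   coefficient of [rnorm u ^+ 2] by at most [1 + 8 * s * rnorm v ^+ 2]; this is
   absorbed by decreasing [s^-1] by [8 * rnorm v ^+ 2], which leaves [s^-1]
   above [8 * tau] throughout. *)
Lemma parallelogram_signs_tail (v : nat -> V) (tau r : R) (n : nat) :
  0 < tau -> 0 <= r -> (forall n, \sum_(k < n) rnorm (v k) ^+ 2 <= tau) ->
  let D := [set nu | (forall k, (k < n)%N -> beta k nu = 1 \/ beta k nu = -1) /\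
    r <= rnorm (\sum_(k < n) sofR F (beta k nu) *: v k)] in
  measurable D /\ (Pr D <= (expR (8^-1 - r ^+ 2 / (16 * tau)))%:E)%E.
Proof.
move=> tau0 r0 vtau.
(* [(L n)^-1] is the coefficient after [n] terms; it starts at [(16 * tau)^-1], and [T n <= tau]
   keeps [L n >= 8 * tau]. *)
pose T n := \sum_(k < n) rnorm (v k) ^+ 2; pose L n := 16 * tau - 8 * T n.
(* The subtracted constant normalises the exponential moment so that [G 0 u >= 1] as soon as
   [rnorm u >= r], as in Chernoff's bound. *)
pose G n (u : V) :=
  expR ((L n)^-1 * (rnorm u ^+ 2 + T n) - r ^+ 2 / (16 * tau)).
have T0 m : 0 <= T m by apply: sumr_ge0 => k _; exact: sqr_ge0.
have GS m (u : V) : (G m (u + v m) + G m (u - v m)) / 2 <= G m.+1 u.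
  have Tm : T m.+1 = T m + rnorm (v m) ^+ 2 by rewrite /T big_ord_recr.
  have := vtau m.+1; rewrite -/(T _) Tm => vm.
  have v2 := sqr_ge0 (rnorm (v m)); have u2 := sqr_ge0 (rnorm u).
  have Lm : L m.+1 = L m - 8 * rnorm (v m) ^+ 2 by rewrite /L Tm; lra.
  have L0 : 0 < L m by rewrite /L; lra.
  set s := (L m)^-1; have s0 : 0 < s by rewrite invr_gt0.
  have : s + 8 * rnorm (v m) ^+ 2 * s ^+ 2 <= (L m.+1)^-1.
    by rewrite Lm; apply: inv_sub_step; [lra|rewrite /L; lra].
  rewrite /G -/s; set s' := (L m.+1)^-1; set q := r ^+ 2 / _ => ss'.
  have e1 w : s * (rnorm w ^+ 2 + T m) - q =
      s * rnorm w ^+ 2 + (s * T m - q) :> R.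
    by rewrite mulrDr addrA.
  rewrite !e1 !(expRD _ (s * T m - q)) -mulrDl mulrAC.
  apply: (@le_trans _ _ (expR (s * (rnorm u ^+ 2 + rnorm (v m) ^+ 2) +
      8 * s ^+ 2 * rnorm u ^+ 2 * rnorm (v m) ^+ 2) * expR (s * T m - q))).
    rewrite ler_wpM2r ?expR_ge0//.
    apply: expR_parallelogram; rewrite ?rnorm_ge0 ?(ltW s0)//.
      rewrite ler_sqr ?nnegrE ?addr_ge0 ?rnorm_ge0//; exact: rnormD.
    rewrite ler_sqr ?nnegrE ?addr_ge0 ?rnorm_ge0// -(rnormN (v m)).
    exact: rnormD.
  rewrite -expRD ler_expR Tm; have := T0 m.
  have ss : s <= s' by nra.
  nra.
move=> D.
have [||mD pD] := signs_tail indep bern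
  (Q := [set w | r <= rnorm w]) GS _ _ n 0 (fun=> false) 0.
- by move=> u; exact: expR_ge0.
- move=> u /= ru; rewrite /G /L /T big_ord0 mulr0 subr0 addr0 -expR0 ler_expR.
  rewrite mulrC -mulrBl divr_ge0 ?mulr_ge0 ?(ltW tau0)// subr_ge0.
  by rewrite ler_sqr ?nnegrE ?rnorm_ge0.
have DE : D = [set nu |
    [/\ forall k, (k < n)%N -> beta k nu = 1 \/ beta k nu = -1,
    forall k, (n <= k < n + 0)%N -> beta k nu = (-1) ^+ false &
    r <= rnorm (0 + \sum_(k < n) sofR F (beta k nu) *: v k)]].
  apply/seteqP; split => nu /=; rewrite add0r => -[]; last by [].
  by split => // k /andP[nk]; rewrite addn0 ltnNge nk.
rewrite DE; split => //; apply: (le_trans pD).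
(* At [u = 0] the exponent has first part [T n / L n], at most [tau / (8 * tau)]: this is the
   [8^-1]. *)
rewrite expr0 mul1r lee_fin ler_expR lerD2r rnorm0 expr0n add0r mulrC.
have Tn : T n <= tau by exact: vtau.
by rewrite /L ler_pdivrMr; lra.
Qed.

End parallelogram_tail.

(** * Orthonormal series and sign changes *)

Section orthonormal_series.
Context (R : realType) (F : scalar_kind) (X : normedModType (scalars R F)).
Variables (dot : {dot X for @sconj R F}) (e : nat -> X).
Hypothesis normX : induces_norm dot.
Hypothesis orthE : forall i j, dot (e i) (e j) = (i == j)%:R.
Local Notation K := (scalars R F).

(** Pythagoras, by induction on the upper end: each new term is orthogonal to the sum before it. A
    general lower end is kept for Cauchy estimates. *)
Lemma rnorm_sqr_orthonormal (a : nat -> K) m n :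
  rnorm (\sum_(m <= k < n) a k *: e k) ^+ 2 =
  \sum_(m <= k < n) rnorm (a k) ^+ 2.
Proof.
have sq (u : X) : sofR F (rnorm u ^+ 2) = dot u u.
  by rewrite expr2 sofRM rnormK -normX expr2.
have inj : injective (@sofR R F) by exact: can_inj (@sofRK R F).
have e1 k : rnorm (e k) ^+ 2 = 1.
  by apply: inj; rewrite sq orthE eqxx sofR1.
have [nm|mn] := leqP n m; first by rewrite !big_geq// rnorm0 expr0n.
rewrite -(subnKC (ltnW mn)); elim: (n - m)%N => [|p IH].
  by rewrite addn0 !big_geq// rnorm0 expr0n.
rewrite addnS !big_nat_recr ?leq_addr//= -IH.
rewrite -[in RHS](mulr1 (rnorm (a _) ^+ 2)).
rewrite -(e1 (m + p)%N) -exprMn -rnormZ.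
set w := \sum_(_ <= _ < _) _.
have w0 : dot w (e (m + p)%N) = 0.
  rewrite linear_sumlz big_nat big1// => k /andP[_ kp].
  by rewrite linearZl_LR /= orthE ltn_eqF// mulr0.
have w0' : dot (e (m + p)%N) w = 0.
  rewrite linear_sumr big_nat big1// => k /andP[_ kp].
  by rewrite linearZr_LR /= orthE gtn_eqF// mulr0.
apply: inj; rewrite sofRD !sq linearDl !linearDr /=.
by rewrite !linearZr_LR !linearZl_LR /= w0 w0' !mulr0 addr0 add0r.
Qed.

Lemma rnorm_sum_signs (b : nat -> R) (c : nat -> K) m n :
  (forall k, b k = 1 \/ b k = -1) ->
  rnorm (\sum_(m <= k < n) (sofR F (b k) * c k) *: e k) =
  rnorm (\sum_(m <= k < n) c k *: e k).
Proof.
move=> hb; apply/eqP; rewrite -(@eqrXn2 _ 2) ?rnorm_ge0//.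
rewrite !rnorm_sqr_orthonormal; apply/eqP/eq_bigr => k _.
rewrite rnormM rnorm_sofR; case: (hb k) => ->.
  by rewrite normr1 mul1r.
by rewrite normrN1 mul1r.
Qed.

(** The squared norms of the partial sums increase to [rnorm x ^+ 2]. *)
Lemma orthonormal_Bessel (c : nat -> K) (x : X) (n : nat) :
  series (fun k => c k *: e k) @ \oo --> x ->
  \sum_(k < n) rnorm (c k) ^+ 2 <= rnorm x ^+ 2.
Proof.
move=> /cvg_rnorm cx; rewrite -(big_mkord predT (fun k => rnorm (c k) ^+ 2)).
have {}cx : (fun n => \sum_(0 <= k < n) rnorm (c k) ^+ 2) @ \oo -->
    rnorm x ^+ 2.
  under eq_fun do rewrite -rnorm_sqr_orthonormal expr2.
  by rewrite expr2; exact: cvgM.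
rewrite -(cvg_lim _ cx)//; apply: nondecreasing_cvgn_le; last exact: cvgP cx.
by apply: nondecreasing_series => k _ _; exact: sqr_ge0.
Qed.

End orthonormal_series.

(** * Measurability of limits and limit inferior of events *)

Section measurable_limits.
Context d (A : measurableType d) (R : realType) (F : scalar_kind).

Lemma measurable_cvgn (X : completeNormedModType (scalars R F))
    (u : nat -> A -> X) :
  (forall n p, measurable_fun setT (fun t => rnorm (u n t - u (n + p)%N t))) ->
  measurable [set t | cvgn (u ^~ t)].
Proof.
move=> mu.
rewrite (_ : [set _ | _] = \bigcap_(j : nat) \bigcup_(N : nat) \bigcap_(p : nat)
    [set t | rnorm (u N t - u (N + p)%N t) < j.+1%:R^-1]); last first.
  apply/seteqP; split => [t /= /rnorm_cvgnP h j _|t h].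
    have [|N hN] := h j.+1%:R^-1; first by rewrite invr_gt0.
    by exists N => // p _; exact: hN.
  (* This [j] satisfies [r^-1 < j.+1], so the radius of index [j] is below [r]. *)
  apply/rnorm_cvgnP => r r0; pose j := Num.truncn r^-1.
  have [N _ hN] := h j I; exists N => p; apply: (lt_trans (hN p I)).
  by rewrite invf_plt ?posrE// truncnS_gt.
apply: bigcap_measurableType => j _; apply: bigcup_measurable => N _.
by apply: bigcap_measurableType => p _; apply: measurable_set_lt.
Qed.

(* Off the measurable set of convergence, [limn] is the constant [point]. *)
Lemma measurable_limn_le (X : completeNormedModType (scalars R F))
    (Y : normedModType (scalars R F)) (P : {linear X -> Y}) (delta : R)
    (u : nat -> A -> X) :
  bounded_operator P ->
  (forall n p, measurable_fun setT (fun t => rnorm (u n t - u (n + p)%N t))) ->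
  (forall n, measurable_fun setT (fun t => rnorm (u n t))) ->
  (forall n, measurable_fun setT (fun t => rnorm (P (u n t)))) ->
  measurable
    [set t | delta * rnorm (limn (u ^~ t)) <= rnorm (P (limn (u ^~ t)))].
Proof.
move=> bP md mu mPu; set E := [set t | _].
pose C := [set t | cvgn (u ^~ t)].
have mC : measurable C by exact: measurable_cvgn.
rewrite -(setUIDK E C); apply: measurableU.
  rewrite setIC; apply: measurable_set_le => //.
    apply: measurable_funM => //.
    apply: (@measurable_fun_cvg _ _ _ C (fun n t => rnorm (u n t))).
      by move=> n; exact: measurable_funS (mu n).
    by move=> t Ct; exact: cvg_rnorm.
  apply: (@measurable_fun_cvg _ _ _ C (fun n t => rnorm (P (u n t)))).
    by move=> n; exact: measurable_funS (mPu n).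
  by move=> t Ct; apply: cvg_rnorm; exact: bounded_operator_cvg.
have [hp|hp] := boolP (delta * rnorm (point : X) <= rnorm (P point)).
  rewrite (_ : _ `\` _ = ~` C); first exact: measurableC.
  by apply/seteqP; split => [t []//|t Ct]; split => //; rewrite /E/= dvgP.
rewrite (_ : _ `\` _ = set0)//; apply/seteqP; split => // t [Et /dvgP Ct].
by move: Et; rewrite /E /= Ct; exact/negP.
Qed.

(** The tail intersections increase with [N] and each lies in [D N], so continuity from below
    carries the uniform bound to their union. *)
Lemma probability_liminf_le (Pr : probability A R) (D : nat -> set A)
    (a : \bar R) :
  (forall n, measurable (D n)) -> (forall n, Pr (D n) <= a)%E ->
  (measurable (\bigcup_N \bigcap_(n in [set n | (N <= n)%N]) D n) /\
  Pr (\bigcup_N \bigcap_(n in [set n | (N <= n)%N]) D n) <= a)%E.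
Proof.
move=> mD Da; pose E N := \bigcap_(n in [set n | (N <= n)%N]) D n.
have mE N : measurable (E N) by apply: bigcap_measurableType.
have mU : measurable (\bigcup_N E N) by exact: bigcup_measurable.
split=> //.
have cE : Pr \o E @ \oo --> Pr (\bigcup_N E N).
  apply: nondecreasing_cvg_mu => // m n mn; apply/subsetPset => t Et k /= nk.
  by apply: Et; exact: leq_trans nk.
apply: (cvge_le _ cE); apply: nearW => N /=; apply: le_trans (Da N).
by apply: le_measure; rewrite ?inE// => t; apply => /=.
Qed.

End measurable_limits.

(** * Almost sure values of the signs *)

Section almost_sure_signs.
Context d (A : measurableType d) (R : realType) (Pr : probability A R).
Variable beta : nat -> {RV Pr >-> R}.
Hypothesis bern : forall k : nat, bernoulli_type (beta k).

(** The two atoms of each [beta k] already have total mass 1, and a countable union of null sets is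
    null. *)
Lemma almost_sure_signs :
  Pr.-negligible (~` [set nu | forall k, beta k nu = 1 \/ beta k nu = -1]).
Proof.
apply: (@negligibleS _ _ _ _ (\bigcup_k
    ~` (beta k @^-1` [set 1] `|` beta k @^-1` [set -1]))).
  move=> nu /=; apply: contra_notP => h k; apply: contrapT => hk.
  by apply: h; exists k.
apply: negligible_bigcup => k.
have m1 a : measurable (beta k @^-1` [set a]) by exact: measurable_funPTI.
apply/negligibleP; first by apply: measurableC; exact: measurableU.
have disj : beta k @^-1` [set 1] `&` beta k @^-1` [set -1] = set0.
  apply/seteqP; split => // nu [/= ->] /eqP; rewrite -subr_eq0 opprK.
  by rewrite -[_ + _]/(2%:R) pnatr_eq0.
apply: (etrans (probability_setC Pr (measurableU _ _ (m1 1) (m1 (-1))))).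
apply: (etrans (congr1 (fun z => 1 - z)%E (measureU Pr (m1 1) (m1 (-1)) disj))).
have [h1 hN1] := bern k.
rewrite [X in (_ - (X + _))%E]h1 [X in (_ - (_ + X))%E]hN1 -EFinD.
by congr EFin; lra.
Qed.

End almost_sure_signs.

(** * Comparison of exponents and conclusion *)

(** Completing the square, [9 / 256 * t ^+ 2 - (expR 1)^-1 * t] is at least
    [- 64 / 9 * (expR 1)^-1 ^+ 2]. As [expR 1 >= 2], this is at least -16/9, above the required
    -15/8. *)
Lemma tail_exponent_le (R : realType) (t : R) :
  8^-1 - 9 / 256 * t ^+ 2 <= 2 - (expR 1)^-1 * t.
Proof.
have e2 : (expR 1)^-1 <= 2^-1 :> R.
  by rewrite lef_pV2 ?posrE ?expR_gt0//; have := expR_ge1Dx (1 : R); lra.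
have e0 : 0 < (expR 1)^-1 :> R by rewrite invr_gt0 expR_gt0.
have : 4 * (expR 1)^-1 ^+ 2 <= 1 :> R by nra.
have := sqr_ge0 (t * 9 / 128 - (expR 1)^-1); nra.
Qed.

Theorem theorem1 (R : realType) (F : scalar_kind)
    (X : completeNormedModType (scalars R F)) (dot : {dot X for @sconj R F})
    (normX : induces_norm dot)
    (sepX : separable X) (infX : infinite_dimensional X)
    (dS : measure_display) (S : measurableType dS)
    (mu : {measure set S -> \bar R})
    (sepY : separable (L2 F mu)) (infY : infinite_dimensional (L2 F mu))
    (P : {linear X -> L2 F mu})
    (bP : bounded_operator P) (injP : injective P)
    (e : nat -> X) (onb : orthonormal_basis dot e)
    (dA : measure_display) (A : measurableType dA) (Pr : probability A R)
    (beta : nat -> {RV Pr >-> R})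
    (indep : mutually_independent beta)
    (bern : forall k : nat, bernoulli_type (beta k))
    (x : X) (c : nat -> scalars R F)
    (xE : series (fun k : nat => c k *: e k) @ \oo --> x) (x0 : x != 0)
    (delta : R) (delta0 : 0 < delta) :
  let xnu (nu : A) : X := randomized e c (fun k : nat => beta k nu) in
  (Pr [set nu : A | (delta * rnorm (xnu nu) <= rnorm (P (xnu nu)))%R] <=
   (expR (2 - (expR 1)^-1 * (delta / Num.sqrt (K_rand P e)))%R)%:E)%E.
Proof.
lazy zeta; pose xnu (nu : A) : X := randomized e c (fun k : nat => beta k nu).
case: onb => orthE _.
have e_neq0 k : e k != 0.
  apply/eqP => ek; have := orthE k k; rewrite ek linear0l eqxx => /eqP.
  by rewrite eq_sym oner_eq0.
have e1 k : rnorm (e k) = 1.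
  apply: (can_inj (@sofRK R F)); rewrite rnormK sofR1.
  apply/eqP; rewrite -(@eqrXn2 _ 2)// expr1n.
  by rewrite normX orthE eqxx.
have [M PM] := bP.
have KP k : rnorm (P (e k)) ^+ 2 <= K_rand P e.
  apply: ub_le_sup; last by exists k.
  exists (M ^+ 2) => _ [j _ <-].
  have := PM (e j); rewrite e1 mulr1 => PMj.
  by rewrite ler_sqr ?nnegrE ?rnorm_ge0// (le_trans _ PMj) ?rnorm_ge0.
(* Injectivity of [P] gives [P (e 0) != 0], so the later divisions by [Num.sqrt (K_rand P e)] and by
   [tau] are genuine. *)
have K0 : 0 < K_rand P e.
  apply: lt_le_trans (KP 0%N); rewrite exprn_gt0// lt_def rnorm_ge0 andbT.
  apply/eqP => /rnorm0_eq0; rewrite -(linear0 P) => /injP/eqP.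
  by rewrite (negPf (e_neq0 _)).
have nx0 : 0 < rnorm x.
  rewrite lt_def rnorm_ge0 andbT; apply: contraNneq x0 => /rnorm0_eq0 ->.
  exact: eqxx.
pose tau := K_rand P e * rnorm x ^+ 2.
have tau0 : 0 < tau by rewrite mulr_gt0// exprn_gt0.
pose v k := c k *: P (e k).
have vtau n : \sum_(k < n) rnorm (v k) ^+ 2 <= tau.
  apply: (@le_trans _ _ (\sum_(k < n) K_rand P e * rnorm (c k) ^+ 2)).
    apply: ler_sum => k _; rewrite rnormZ exprMn mulrC.
    by rewrite ler_wpM2r ?sqr_ge0.
  rewrite -mulr_sumr ler_wpM2l ?(ltW K0)//.
  exact: (orthonormal_Bessel normX orthE).
pose r := 3 / 4 * (delta * rnorm x).
have r0 : 0 <= r by rewrite !mulr_ge0 ?(ltW delta0) ?(ltW nx0).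
have tail n := parallelogram_signs_tail indep bern
  (@L2_parallelogram _ _ _ F mu) n tau0 r0 vtau.
pose u n (nu : A) := series (fun k => (sofR F (beta k nu) * c k) *: e k) n : X.
have mbeta k : measurable_fun setT (beta k) by exact: measurable_funPT.
have uE n nu : u n nu = 0 + \sum_(k < n) sofR F (beta k nu) *: (c k *: e k).
  rewrite add0r /u /series /= big_mkord.
  by apply: eq_bigr => k _; rewrite scalerA.
have PuE n nu : P (u n nu) = \sum_(k < n) sofR F (beta k nu) *: v k.
  rewrite uE add0r linear_sum; apply: eq_bigr => k _.
  by rewrite 2!linearZ.
(* Monotonicity of [Pr] is applied to measurable sets only, so the event itself must be shown
   measurable. *)
have mB : measurable [set nu | delta * rnorm (xnu nu) <= rnorm (P (xnu nu))].
  apply: (@measurable_limn_le _ _ _ _ _ _ P delta u bP).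
  - move=> n p.
    have := measurable_rnorm_sum (fun k => c (k + n)%N *: e (k + n)%N) p 0
      (fun k => mbeta (k + n)%N).
    apply: eq_measurable_fun => nu _; rewrite -[RHS]rnormN opprB /u.
    rewrite sub_series_geq ?leq_addr// add0r -[X in \sum_(X <= _ < _) _]add0n.
    rewrite big_addn addKn big_mkord.
    by congr rnorm; apply: eq_bigr => k _; rewrite scalerA.
  - move=> n; under eq_fun do rewrite uE.
    exact: (measurable_rnorm_sum (fun k => c k *: e k) n 0 mbeta).
  - move=> n; apply: eq_measurable_fun (measurable_rnorm_sum v n 0 mbeta).
    by move=> nu _; rewrite PuE add0r.
set B := [set nu | _] in mB; rewrite -[X in (Pr X <= _)%E]/B.
pose D n := [set nu |
    (forall k, (k < n)%N -> beta k nu = 1 \/ beta k nu = -1) /\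
    r <= rnorm (\sum_(k < n) sofR F (beta k nu) *: v k)].
pose E0 := [set nu | forall k, beta k nu = 1 \/ beta k nu = -1].
(* Where all signs are 1 or -1, the event forces the partial sums to exceed [r] from some index
   on. *)
have BD : B `<=` ~` E0 `|` \bigcup_N \bigcap_(n in [set n | (N <= n)%N]) D n.
  move=> nu Bnu; have [E0nu|] := pselect (E0 nu); [right|by left].
  (* Sign changes preserve the norms of all blocks of the series of [x], so the signed series is
     Cauchy too and [limn] is its true sum. *)
  have cu : u ^~ nu @ \oo --> xnu nu.
    suff : cvgn (u ^~ nu) by [].
    apply/rnorm_cvgnP => s s0.
    have /rnorm_cvgnP/(_ s s0)[N hN] : cvgn (series (fun k => c k *: e k)).
      exact: cvgP xE.
    exists N => p; have := hN p.
    rewrite -rnormN opprB -[in X in _ -> X]rnormN opprB /u.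
    by rewrite !sub_series_geq ?leq_addr// (rnorm_sum_signs normX orthE).
  have nxnu : rnorm (xnu nu) = rnorm x.
    have h := cvg_rnorm cu; have h' := cvg_rnorm xE.
    rewrite -(cvg_lim _ h)// -(cvg_lim _ h')//; congr (limn _).
    apply/funext => n; rewrite /u /series /=.
    by rewrite (rnorm_sum_signs normX orthE).
  (* The factor 3/4 in [r] makes this strict, which passes to all late partial sums. *)
  have rB : r < rnorm (P (xnu nu)).
    apply: lt_le_trans Bnu; rewrite nxnu /r.
    by have := mulr_gt0 delta0 nx0; lra.
  have := cvgr_gt _ (cvg_rnorm (bounded_operator_cvg bP cu)) _ rB.
  move=> [N _ hN]; exists N => // n /= Nn; split; first by move=> k _.
  by rewrite -PuE; apply/ltW/hN.
have [mL PL] :=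
  probability_liminf_le (fun n => (tail n).1) (fun n => (tail n).2).
have [Z [mZ PZ E0Z]] := almost_sure_signs bern.
apply: (@le_trans _ _ (Pr (Z `|`
    \bigcup_N \bigcap_(n in [set n | (N <= n)%N]) D n))).
  apply: le_measure; rewrite ?inE//; first exact: measurableU.
  by move=> nu /BD[/E0Z|]; [left|right].
apply: (le_trans (measureU2 _ mZ mL)); rewrite [X in (X + _)%E]PZ add0e.
apply: (le_trans PL); rewrite lee_fin ler_expR.
(* The constant is [(3 / 4) ^+ 2 / 16]; the factor [rnorm x ^+ 2] cancels. *)
have -> : r ^+ 2 / (16 * tau) = 9 / 256 * (delta / Num.sqrt (K_rand P e)) ^+ 2.
  rewrite [in RHS]exprMn exprVn sqr_sqrtr ?(ltW K0)// /r /tau.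
  by field; rewrite !lt0r_neq0.
exact: tail_exponent_le.
Qed.
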